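(* For every prime power $q$ there exists a set $\mathcal X$ of $\frac{q^6-1}{q-1}$ points of $\mathrm{PG}(13,q)$ which is a $(3,2)$-set and which is transitive, i.e. the group of projectivities of $\mathrm{PG}(13,q)$ stabilizing $\mathcal X$ acts transitively on the points of $\mathcal X$.
   Context: For integers $r,s$, an $(r,s)$-set of $\mathrm{PG}(n,q)$ is a set $\mathcal X$ of points such that: (i) every $s$-dimensional projective subspace contains at most $r$ points of $\mathcal X$; (ii) $\mathcal X$ spans $\mathrm{PG}(n,q)$; (iii) some $(s+1)$-dimensional projective subspace contains $r+2$ points of $\mathcal X$. *)

(* Defs.v *)
From HB Require Import structures.
From mathcomp Require Import all_boot all_order all_algebra all_fingroup all_field.
Set Implicit Arguments. Unset Strict Implicit. Unset Printing Implicit Defensive.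
Import GRing.Theory.
Local Open Scope ring_scope.

(* Projective space PG(n, F) over a finite field F, modelled in F^(n+1) (row
   vectors).  A subspace of PG(n,F) is represented by a square matrix whose
   row space is the underlying vector subspace; a projective subspace of
   dimension s is a row space of rank s+1.  A *point* is represented
   canonically by the normalized matrix <<P>> of a rank-1 row space. *)

Section PG.
Variables (F : finFieldType) (n : nat).

Definition pg_point (P : 'M[F]_(n.+1)) : bool :=
  (\rank P == 1)%N && (<<P>>%MS == P).

Definition pg_pointset (X : {set 'M[F]_(n.+1)}) : Prop :=
  forall P, P \in X -> pg_point P.

Definition pts_in (X : {set 'M[F]_(n.+1)}) (S : 'M[F]_(n.+1)) :=
  [set P in X | (P <= S)%MS].

Definition rs_set (r s : nat) (X : {set 'M[F]_(n.+1)}) : Prop :=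
  [/\ (forall S : 'M[F]_(n.+1), \rank S = s.+1 -> (#|pts_in X S| <= r)%N),
      (1%:M <= \sum_(P in X) P)%MS
    & exists S : 'M[F]_(n.+1), \rank S = s.+2 /\ (r.+2 <= #|pts_in X S|)%N].

Definition proj_act (A : 'M[F]_(n.+1)) (P : 'M[F]_(n.+1)) : 'M[F]_(n.+1) :=
  <<P *m A>>%MS.

Definition projectivity (A : 'M[F]_(n.+1)) : bool := A \in unitmx.

Definition stabilizes (A : 'M[F]_(n.+1)) (X : {set 'M[F]_(n.+1)}) : Prop :=
  forall P, P \in X -> proj_act A P \in X.

Definition pg_transitive (X : {set 'M[F]_(n.+1)}) : Prop :=
  forall P Q, P \in X -> Q \in X ->
    exists A, [/\ projectivity A, stabilizes A X & proj_act A P = Q].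

End PG.

(* Main.v *)
Require Import Defs.
From HB Require Import structures.
From mathcomp Require Import all_boot all_order all_algebra all_fingroup all_field.
From mathcomp Require Import ring zify.
Set Implicit Arguments. Unset Strict Implicit. Unset Printing Implicit Defensive.
Import GRing.Theory.
Local Open Scope ring_scope.

(** Let L be the field of order q^6 and K its subfield of order q^2.  The set
    consists of the points spanned by
      pt x = (x^(1+q+q^3), x^(1+q+q^4), x^(1+q^2+q^4)) in L * L * K, x in L^*,
    an F-space of dimension 14 on which L^* acts by multiplication, transitively
    on these points.  Write x_i = x^(q^i).  The eight monomials x_i x_j x_k with
    i in {0,1}, j in {2,3}, k in {4,5} are Galois conjugates of the entries of
    pt x, so that
      (x_0 a_1 - x_1 a_0) (x_2 b_3 - x_3 b_2) (x_4 c_5 - x_5 c_4)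
    is F-linear in pt x.  It vanishes exactly when x is an F-multiple of a, b or
    c, so it separates one point from three others, and any four points are
    independent.  The points span because the fourteen conjugate monomials have
    distinct exponents below q^6.  For q >= 4 five points in a solid are found on
    the twisted cubic given by x in K; for q = 2, 3 they are given explicitly. *)

(** * The maps x -> x^(q^k) on an extension of F, and the extension with q^k elements *)

Section Frobenius.
Variables (F : finFieldType) (L : fieldExtType F).
Local Notation q := #|F|.
Local Notation fL := (finvect_type L).

Lemma finField_card_gt0 : (0 < q)%N. Proof. exact: ltnW (finNzRing_gt1 F). Qed.

Definition frob (k : nat) (x : L) : L := x ^+ (q ^ k).

Lemma frob_is_linear k : linear (frob k).
Proof.
have [p p_pr pcharF] := finPcharP F.
have pcharL : p \in [pchar L] by rewrite pchar_lalg.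
move=> a x y; rewrite /frob exprDn_pchar; last first.
  rewrite (eq_pnat _ (pcharf_eq pcharL)) (card_pprimeChar pcharF).
  by rewrite -expnM pnatX pnat_id.
congr (_ + _); rewrite exprZn; congr (_ *: _).
by elim: k => // k IHk; rewrite expnS exprM expf_card.
Qed.
HB.instance Definition _ k := GRing.isLinear.Build F L L _ (frob k) (frob_is_linear k).

Lemma frob_is_monoid_morphism k : monoid_morphism (frob k).
Proof. by split=> [|x y]; rewrite /frob ?expr1n ?exprMn. Qed.
HB.instance Definition _ k :=
  GRing.isMonoidMorphism.Build L L (frob k) (frob_is_monoid_morphism k).

Lemma frobD i j x : frob i (frob j x) = frob (i + j) x.
Proof. by rewrite /frob -exprM -expnD addnC. Qed.

Lemma frob_eq0 k x : (frob k x == 0) = (x == 0).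
Proof. by rewrite /frob expf_eq0 expn_gt0 finField_card_gt0. Qed.

Lemma frob1_fixed x : frob 1 x = x -> exists c : F, x = c%:A.
Proof.
move=> e; apply/vlineP; have := Fermat's_little_theorem (1%AS : {subfield L}) x.
by rewrite dimv1 -/(frob 1 x) e eqxx.
Qed.

Lemma frob_card n : #|fL| = (q ^ n)%N -> forall x, frob n x = x.
Proof. by move=> oL x; rewrite /frob -oL (expf_card (x : fL)). Qed.

Lemma card_ext : #|fL| = (q ^ \dim {:L})%N.
Proof.
transitivity #|{:fL}%VS|; last exact: card_vspace.
by apply: eq_card => x; rewrite memvf.
Qed.

End Frobenius.

(** In the splitting field of X^m - X the roots are simple, because the derivative is -1, and they
    lie in the fixed field of [frob k]. As they generate L, every element of L is a root, so L has
    exactly m elements. *)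
Lemma finField_ext_exists (F : finFieldType) (k : nat) : (0 < k)%N ->
  {L : fieldExtType F | #|finvect_type L| = (#|F| ^ k)%N}.
Proof.
move=> k_gt0; set m := (#|F| ^ k)%N.
have m_gt1 : (m > 1)%N by rewrite -(exp1n k) ltn_exp2r ?finNzRing_gt1.
pose Q (R : nzRingType) := 'X^m - 'X : {poly R}.
have szQ R : size (Q R) = m.+1.
  by rewrite /Q size_polyDl size_polyXn // size_polyN size_polyX ltnS.
have /FinSplittingFieldFor[/= L splitL]: Q F != 0.
  by rewrite -size_poly_gt0 szQ.
exists L; have [zs Qzs genL] := splitL.
rewrite rmorphB rmorphXn /= map_polyX -/(Q L) in Qzs.
have m0 : m%:R = 0 :> L.
  have [p _ pcharF] := finPcharP F; have := finNzRing_gt1 F.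
  rewrite /m (card_pprimeChar pcharF) -expnM natrX.
  rewrite (pcharf0 (etrans (pchar_lalg L p) pcharF)) expr0n muln_eq0.
  by case: logn => // n _; rewrite (gtn_eqF k_gt0).
have zs_uniq: uniq zs.
  rewrite -separable_prod_XsubC -(eqp_separable Qzs) unlock.
  rewrite derivB derivXn derivX -scaler_nat m0 scale0r sub0r.
  by rewrite -scaleN1r coprimepZr ?coprimep1 // oppr_eq0 oner_eq0.
pose phi : {lrmorphism L -> L} := frob k.
pose E := fixedSpace (linfun_ahom phi).
have zsE z : z \in zs -> z \in E.
  rewrite -root_prod_XsubC -(eqp_root Qzs) /root !hornerE subr_eq0 => /eqP Dz.
  by apply/fixedSpaceP; rewrite lfunE.
have defE: E = {:L}%VS.
  apply/eqP; rewrite eqEsubv subvf -genL; apply/Fadjoin_seqP.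
  by split; [apply: sub1v | apply: zsE].
suffices /eq_card->: finvect_type L =i zs.
  apply: succn_inj; rewrite (card_uniqP _) // -(szQ L) (eqp_size Qzs).
  by rewrite size_prod_XsubC.
move=> z; rewrite -root_prod_XsubC -(eqp_root Qzs) /root !hornerE subr_eq0.
have /fixedSpaceP: z \in E by rewrite defE memvf.
by rewrite lfunE => /eqP.
Qed.

(** * Base-q expansions with digits 0 and 1 *)

Section Digits.
Variable q : nat.

(* Least significant digit first. *)
Definition dig (s : bitseq) : nat := foldr (fun (b : bool) n => (b + q * n)%N) 0%N s.

Lemma dig_inj s t : (1 < q)%N -> size s = size t -> dig s = dig t -> s = t.
Proof.
move=> q_gt1; elim: s t => [|b s IHs] [|c t] //= [eq_sz] e.
have ebc : b = c.
  have := congr1 (modn^~ q) e; rewrite !(addnC (nat_of_bool _)) !(mulnC q) !modnMDl.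
  by rewrite !modn_small; [case: (b) (c) => [] [] | case: (c) | case: (b)]; lia.
rewrite ebc in e *; congr (_ :: _); apply: IHs => //.
by move/addnI/eqP: e; rewrite eqn_pmul2l ?(ltnW q_gt1) // => /eqP.
Qed.

Lemma dig_lt s : (1 < q)%N -> (dig s < q ^ size s)%N.
Proof.
move=> q_gt1; elim: s => //= b s IHs; rewrite expnS.
have : (q * (dig s).+1 <= q * q ^ size s)%N by rewrite leq_mul2l IHs orbT.
by case: b; lia.
Qed.

Lemma dig_rcons s b : dig (rcons s b) = (dig s + q ^ size s * b)%N.
Proof. by elim: s => [|c s IHs] /=; rewrite ?IHs ?expnS; lia. Qed.

End Digits.

(** * The vectors [pt x] and the linear maps that separate them *)

Section Embedding.
Variables (F : finFieldType) (L : fieldExtType F).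
Local Notation q := #|F|.
Local Notation fL := (finvect_type L).

(** With x_i = x^(q^i), this is the product of the x_i over the positions i at which s is true. *)
Definition mon (s : bitseq) (x : L) : L := x ^+ dig q s.

Lemma mon_frob b0 b1 b2 b3 b4 b5 x : mon [:: b0; b1; b2; b3; b4; b5] x =
  x ^+ b0 * frob 1 x ^+ b1 * frob 2 x ^+ b2 * frob 3 x ^+ b3 * frob 4 x ^+ b4
   * frob 5 x ^+ b5.
Proof. by rewrite /mon /frob -!exprM -!exprD /=; congr (_ ^+ _); lia. Qed.

Hypothesis oL : #|fL| = (q ^ 6)%N.

Let frob6 (x : L) : frob 6 x = x. Proof. exact: frob_card. Qed.

(** Since x^(q^6) = x, raising to the power q rotates the six digits of the exponent. *)
Lemma frob_mon k s x : size s = 6%N -> frob k (mon s x) = mon (iter k (rotr 1) s) x.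
Proof.
move=> sz6; elim: k => [|k IHk]; first by rewrite /frob expn0 expr1.
rewrite -add1n -frobD {}IHk /=.
have: size (iter k (rotr 1) s) = 6%N by elim: k => //= k; rewrite size_rotr.
case/lastP: (iter k _ s) => // t b; rewrite size_rcons rotr1_rcons => -[sz5].
rewrite /mon /frob -exprM dig_rcons sz5 /=.
have ->: ((dig q t + q ^ 5 * b) * q ^ 1 = b * q ^ 6 + q * dig q t)%N.
  by rewrite expn1 [(q ^ 6)%N]expnS; ring.
by rewrite exprD exprM -/(frob 6 (x ^+ b)) frob6 -exprD.
Qed.

(** The third entry of [pt x] stays in the subfield of order q^2, but the third factor is all of L;
    the 14-dimensional space is recovered later as the span of the points. *)
Definition ambient := (L * L * L)%type.
HB.instance Definition _ := Vector.on ambient.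

(** The index sets {0,1,3}, {0,1,4} and {0,2,4}. Their rotations include all eight choices of one
    index from each of {0,1}, {2,3}, {4,5}. The last word is invariant under two rotations. *)
Definition base_word (c : nat) : bitseq :=
  nth [::] [:: [:: true; true; false; true; false; false];
               [:: true; true; false; false; true; false];
               [:: true; false; true; false; true; false]] c.

Definition pt (x : L) : ambient :=
  (mon (base_word 0) x, mon (base_word 1) x, mon (base_word 2) x).

Definition psi (c k : nat) (v : ambient) : L :=
  frob k (nth 0 [:: v.1.1; v.1.2; v.2] c).

Lemma psi_is_linear c k : linear (psi c k).
Proof.
by move=> a u v; rewrite /psi -linearP; congr (frob k _);
   case: c => [|[|[|c]]] //=; rewrite nth_nil scaler0 addr0.
Qed.
HB.instance Definition _ c k :=
  GRing.isLinear.Build F ambient L _ (psi c k) (psi_is_linear c k).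

Lemma psi_pt c k x : (c < 3)%N ->
  psi c k (pt x) = mon (iter k (rotr 1) (base_word c)) x.
Proof. by case: c => [|[|[|c]]] // _; rewrite /psi frob_mon. Qed.

Lemma expf_dig (c : F) s : c ^+ dig q s = c ^+ count id s.
Proof. by elim: s => //= b s IHs; rewrite !exprD exprM expf_card IHs. Qed.

(** Scalars of F satisfy c^q = c, and each base word has three true digits. *)
Lemma ptZ c x : pt (c *: x) = c ^+ 3 *: pt x.
Proof. by rewrite /pt /mon !exprZn !expf_dig. Qed.

Lemma pt0 : pt 0 = 0.
Proof. by rewrite -[X in pt X](scale0r 0) ptZ expr0n scale0r. Qed.

(** The Moore determinant of x and y: for nonzero y it vanishes exactly when x is an F-multiple of
    y. *)
Definition cross (x y : L) := x * frob 1 y - frob 1 x * y.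

Lemma crossxx x : cross x x = 0.
Proof. by rewrite /cross mulrC subrr. Qed.

Lemma cross0 y : cross 0 y = 0.
Proof. by rewrite /cross raddf0 !mul0r subrr. Qed.

Lemma cross_sym x y : cross y x = - cross x y.
Proof. by rewrite /cross opprB mulrC [x * _]mulrC. Qed.

Lemma cross_eq0 x y : y != 0 -> cross x y = 0 -> exists c : F, x = c *: y.
Proof.
move=> y0 /eqP; rewrite subr_eq0 => /eqP e.
have [c Dc]: exists c : F, x / y = c%:A.
  apply: frob1_fixed; rewrite rmorphM /= fmorphV; apply/eqP.
  by rewrite eqr_div ?frob_eq0 // -e.
by exists c; rewrite -mulr_algl -Dc divfK.
Qed.

(** The expanded product of [sep_pt], with each monomial x_i x_j x_k replaced by the [psi] that
    takes this value on [pt x]. *)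
Definition sep (y1 y2 y3 : L) (v : ambient) : L :=
    frob 1 y1 * frob 3 y2 * frob 5 y3 * psi 2 0 v
  - frob 1 y1 * frob 3 y2 * frob 4 y3 * psi 0 5 v
  - frob 1 y1 * frob 2 y2 * frob 5 y3 * psi 0 3 v
  + frob 1 y1 * frob 2 y2 * frob 4 y3 * psi 1 5 v
  - y1 * frob 3 y2 * frob 5 y3 * psi 0 1 v
  + y1 * frob 3 y2 * frob 4 y3 * psi 1 1 v
  + y1 * frob 2 y2 * frob 5 y3 * psi 1 3 v
  - y1 * frob 2 y2 * frob 4 y3 * psi 2 1 v.

Lemma sep_is_linear y1 y2 y3 : linear (sep y1 y2 y3).
Proof.
(* Scaling by a becomes multiplication by an element of L, so that [ring] applies. *)
move=> a u v; have [d aE]: exists d : L, forall y, a *: y = d * y.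
  by exists a%:A => y; rewrite mulr_algl.
by rewrite /sep !psi_is_linear !aE; ring.
Qed.
HB.instance Definition _ y1 y2 y3 :=
  GRing.isLinear.Build F ambient L _ (sep y1 y2 y3) (sep_is_linear y1 y2 y3).

Lemma sep_pt y1 y2 y3 x :
  sep y1 y2 y3 (pt x) = cross x y1 * frob 2 (cross x y2) * frob 4 (cross x y3).
Proof.
rewrite /sep !psi_pt // /base_word /= !mon_frob /cross !rmorphB !rmorphM /= !frobD /=.
by rewrite !(expr0, expr1, mulr1, mul1r); ring.
Qed.

End Embedding.

(** * The span of the points has dimension 14 *)

Section Span.
Variables (F : finFieldType) (L : fieldExtType F).
Local Notation q := #|F|.
Local Notation fL := (finvect_type L).
Hypothesis oL : #|fL| = (q ^ 6)%N.

Definition ptspan : {vspace ambient L} := <<[seq pt (x : L) | x : fL]>>%VS.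

Lemma pt_span x : pt x \in ptspan.
Proof. by apply: memv_span; apply/mapP; exists (x : fL); rewrite ?mem_enum. Qed.

(* For j < 14 these are the exponents, in base q, of the conjugates of the
   entries of pt: six for each of the first two and two for the last one. *)
Definition word (j : nat) : bitseq := iter (j %% 6)%N (rotr 1) (base_word (j %/ 6)%N).

(** Distinct words have distinct exponents below q^6, so the combination is a polynomial of degree
    below q^6 with q^6 roots. It is therefore zero, and the [u i] are among its coefficients. *)
Lemma mon_free (I : finType) (w : I -> bitseq) (u : I -> L) :
    injective w -> (forall i, size (w i) = 6%N) ->
  (forall x, \sum_i u i * mon (w i) x = 0) -> forall i, u i = 0.
Proof.
move=> w_inj w_size u0 j; have q_gt1 := finNzRing_gt1 F.
pose p := \sum_i u i *: 'X^(dig q (w i)).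
have p_coef : p`_(dig q (w j)) = u j.
  rewrite coef_sum (bigD1 j) //= coefZ coefXn eqxx mulr1 big1 ?addr0 // => i ij.
  rewrite coefZ coefXn; case: eqP => [e|]; last by rewrite mulr0.
  by case/eqP: ij; apply/w_inj/(dig_inj q_gt1 _ (esym e)); rewrite !w_size.
have: p = 0.
  apply/eqP; apply: contraT => p_neq0.
  have: (#|fL| < size p)%N.
    rewrite cardE; apply: (@max_poly_roots L p (enum fL)) p_neq0 _ (enum_uniq fL).
    apply/allP => x _; apply/rootP; rewrite horner_sum; apply: etrans (u0 x).
    by apply: eq_bigr => i _; rewrite !hornerE.
  rewrite oL ltnNge (leq_trans (size_sum _ _ _)) //.
  apply/bigmax_leqP => i _; apply: leq_trans (size_scale_leq _ _) _.
  by rewrite size_polyXn -(w_size i) dig_lt.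
by rewrite -p_coef => ->; rewrite coef0.
Qed.

(** Otherwise the two monomials with coefficients 1 and -1 would contradict [mon_free]. *)
Lemma mon_neq s t : size s = 6%N -> size t = 6%N -> s != t ->
  exists x : L, mon s x != mon t x.
Proof.
move=> sz_s sz_t st.
have [/existsP[x ?]|/existsPn e] := boolP [exists x : fL, mon s x != mon t x].
  by exists x.
suff: 1 = 0 :> L by move/eqP; rewrite oner_eq0.
apply: (@mon_free _ (fun c : bool => if c then s else t) (fun c => (-1) ^+ c)) false.
- by case=> [] [] // E; rewrite E eqxx in st.
- by case.
- move=> x; rewrite big_bool /= mulN1r mul1r addrC; apply/eqP; rewrite subr_eq0.
  by rewrite eq_sym -[_ == _]negbK (e x).
Qed.

Lemma size_word (j : 'I_14) : size (word j) = 6%N.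
Proof.
apply/eqP; move: j; apply/forallP.
by rewrite -(big_andE xpredT) !big_ord_recl big_ord0.
Qed.

Lemma word_inj : injective (fun j : 'I_14 => word j).
Proof.
move=> i j /eqP; have := @nth_uniq _ [::] (mkseq word 14) i j.
rewrite size_mkseq !nth_mkseq // => -> //.
by move/eqP/val_inj.
Qed.

(** In a smaller span the fourteen maps [psi], evaluated on a basis, would satisfy a nontrivial
    relation over L. By F-linearity the same relation would hold at every [pt x], against
    [mon_free]. *)
Lemma dim_ptspan_ge : (14 <= \dim ptspan)%N.
Proof.
rewrite leqNgt; apply/negP => dimW.
pose Q : 'M[L]_(\dim ptspan, 14) :=
  \matrix_(i, j) psi (j %/ 6)%N (j %% 6)%N (vbasis ptspan)`_i.
have: kermx Q^T != 0.
  rewrite kermx_eq0 /row_free mxrank_tr; apply: contraL dimW => /eqP <-.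
  by rewrite -leqNgt rank_leq_row.
case/rowV0Pn => u /sub_kermxP uQ; apply/negP; rewrite negbK; apply/eqP/rowP => j.
rewrite mxE; move: j; apply: (mon_free word_inj size_word) => x.
transitivity (\sum_(j < 14) u 0 j * psi (j %/ 6)%N (j %% 6)%N (pt x)).
  apply: eq_bigr => j _; rewrite psi_pt //.
  by rewrite ltn_divLR // (leq_trans (ltn_ord j)).
rewrite (coord_vbasis (pt_span x)).
under eq_bigr => j _ do rewrite linear_sum mulr_sumr.
rewrite exchange_big big1 //= => i _.
under eq_bigr => j _ do rewrite linearZ -scalerAr.
rewrite -scaler_sumr; have /rowP/(_ i) := uQ; rewrite !mxE => e.
rewrite [X in _ *: X](_ : _ = 0) ?scaler0 //; apply: etrans e.
by apply: eq_bigr => j _; rewrite !mxE.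
Qed.

(** The fixed elements are roots of X^(q^n) - X, so there are at most q^n of them. *)
Lemma dim_fixed_le n : (0 < n)%N ->
  (\dim (lker (linfun (@frob F L n) - \1%VF)%R) <= n)%N.
Proof.
move=> n_gt0; have q_gt1 := finNzRing_gt1 F; set K := lker _.
pose p := 'X^(q ^ n) - 'X : {poly L}.
have p_size : size p = (q ^ n).+1.
  have qn_gt1 : (1 < q ^ n)%N by rewrite -(exp1n n) ltn_exp2r.
  by rewrite size_polyDl size_polyXn // size_polyN size_polyX ltnS.
have K_root (x : L) : x \in K -> root p x.
  by rewrite memv_ker add_lfunE opp_lfunE id_lfunE lfunE rootE !hornerE.
rewrite -(leq_exp2l _ _ q_gt1) -(card_vspace (K : {vspace fL})) cardE.
rewrite -ltnS -p_size; apply: (@max_poly_roots L p); last exact: enum_uniq.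
  by rewrite -size_poly_gt0 p_size.
by apply/allP => x; rewrite (@mem_enum fL); apply: K_root.
Qed.

Lemma dim_ptspan : \dim ptspan = 14%N.
Proof.
apply/eqP; rewrite eqn_leq dim_ptspan_ge andbT.
have dimL : \dim {:L} = 6%N.
  have := card_ext L; rewrite oL => /eqP; rewrite eqn_exp2l ?finNzRing_gt1 //.
  by move/eqP.
have dimV : \dim {:ambient L} = 18%N.
  by rewrite dimvf -[dim _]/(dim L + dim L + dim L)%N -dimvf dimL.
pose p3 : {linear ambient L -> L} := snd.
(* The kernel of the third projection contributes at most 18 - 6 = 12 dimensions, and the image at
   most 2, because it is fixed by [frob 2]. *)
rewrite -(limg_ker_dim (linfun p3)) (@leq_add _ _ 12 2) //.
  apply: leq_trans (dimvS (capvSr _ _)) _.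
  have := limg_ker_dim (linfun p3) fullv; rewrite capfv dimV.
  suff ->: (linfun p3 @: fullv)%VS = fullv by rewrite dimL; lia.
  apply/vspaceP => y; rewrite memvf; apply/memv_imgP.
  by exists (0, 0, y); rewrite ?memvf // lfunE.
apply: leq_trans (dimvS _) (dim_fixed_le (isT : 0 < 2)%N).
rewrite limg_span; apply/span_subvP => _ /mapP[_ /mapP[x _ ->] ->].
rewrite memv_ker add_lfunE opp_lfunE id_lfunE !lfunE /= frob_mon //.
by rewrite subrr.
Qed.

End Span.

(** Unit rows outside the current row space are added one at a time, each raising the rank by
    one. *)
Lemma rank_extend (K : fieldType) n (U : 'M[K]_n) r : (\rank U <= r <= n)%N ->
  exists2 S : 'M[K]_n, (U <= S)%MS & \rank S = r.
Proof.
case/andP; elim: r => [|r IHr] leUr lern.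
  by exists U => //; apply/eqP; rewrite -leqn0.
move: leUr; rewrite leq_eqVlt ltnS => /predU1P[<-|leUr]; first by exists U.
have [S US rS] := IHr leUr (ltnW lern).
have: ~~ (1%:M <= S)%MS.
  by apply: contraTN lern => /mxrankS; rewrite mxrank1 rS -leqNgt.
case/row_subPn => i iS; exists (S + row i 1%:M)%MS.
  exact: submx_trans US (addsmxSl _ _).
apply/eqP; rewrite eqn_leq; apply/andP; split.
  rewrite (leq_trans (mxrank_adds_leqif _ _)) // rS.
  by rewrite -[r.+1]addn1 leq_add2l rank_leq_row.
rewrite -rS ltn_neqAle mxrankS ?addsmxSl // andbT; apply: contra iS.
by rewrite mxrank_leqif_eq ?addsmxSl // => /andP[_]; apply: submx_trans (addsmxSr _ _).
Qed.

(** * The point set in coordinates over F: size, planes, span, transitivity *)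

Section Coordinates.
Variables (F : finFieldType) (L : fieldExtType F).
Local Notation q := #|F|.
Local Notation fL := (finvect_type L).
Hypothesis oL : #|fL| = (q ^ 6)%N.
Variable b : 14.-tuple (ambient L).
Hypothesis bP : basis_of (ptspan L) b.

Definition co (v : ambient L) : 'rV[F]_14 := \row_i coord b i v.
Definition emb (r : 'rV[F]_14) : ambient L := \sum_i r 0 i *: b`_i.

Lemma co_is_linear : linear co.
Proof. by move=> a u v; apply/rowP=> i; rewrite !mxE linearP. Qed.
HB.instance Definition _ :=
  GRing.isLinear.Build F (ambient L) 'rV[F]_14 _ co co_is_linear.

Lemma emb_is_linear : linear emb.
Proof.
move=> a u v; rewrite /emb scaler_sumr -big_split; apply: eq_bigr => i _.
by rewrite !mxE scalerDl scalerA.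
Qed.
HB.instance Definition _ :=
  GRing.isLinear.Build F 'rV[F]_14 (ambient L) _ emb emb_is_linear.

Lemma emb_co v : v \in ptspan L -> emb (co v) = v.
Proof.
move=> vW; rewrite [RHS](coord_basis bP vW).
by apply: eq_bigr => i _; rewrite mxE.
Qed.

Lemma co_emb r : co (emb r) = r.
Proof.
apply/rowP => i; rewrite mxE coord_sum_free //.
exact: basis_free bP.
Qed.

Lemma emb_span r : emb r \in ptspan L.
Proof.
apply: rpred_sum => i _; apply: rpredZ; apply: (basis_mem bP).
by apply: mem_nth; rewrite size_tuple.
Qed.

Definition phi (x : L) : 'rV[F]_14 := co (pt x).

Lemma emb_phi x : emb (phi x) = pt x.
Proof. exact: emb_co (pt_span x). Qed.

Lemma phiZ c x : phi (c *: x) = c ^+ 3 *: phi x.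
Proof. by rewrite /phi ptZ linearZ. Qed.

Lemma phi_neq0 x : x != 0 -> phi x != 0.
Proof.
move=> x0; apply: contraNneq x0 => e; have := emb_phi x.
rewrite e linear0 => -[/esym/eqP].
by rewrite /mon expf_eq0 => /andP[].
Qed.

Definition ppt (x : L) : 'M[F]_14 := <<phi x>>%MS.

Definition pts : {set 'M[F]_14} := [set ppt x | x : fL & x != 0].

Lemma pptP P : reflect (exists2 x : L, x != 0 & P = ppt x) (P \in pts).
Proof.
by apply: (iffP imsetP) => -[x + ->]; rewrite ?inE => x0; exists x; rewrite ?inE.
Qed.

Lemma pts_point : pg_pointset pts.
Proof.
move=> P /pptP[x x0 ->]; rewrite /pg_point /ppt genmx_id eqxx andbT.
by rewrite mxrank_gen rank_rV phi_neq0.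
Qed.

Lemma pptZ c x : c != 0 -> ppt (c *: x) = ppt x.
Proof.
move=> c0; apply/genmxP; rewrite phiZ; apply/eqmxP/eqmx_scale.
by rewrite expf_eq0 (negPf c0).
Qed.

(** [sep y y y] kills [pt y], hence also its multiple [pt x], where its value is a product of
    conjugates of [cross x y]. *)
Lemma ppt_inj x y : x != 0 -> y != 0 -> ppt x = ppt y ->
  exists2 c : F, c != 0 & x = c *: y.
Proof.
move=> x0 y0 /genmxP/andP[/sub_rVP[a /(congr1 emb)]] + _.
rewrite linearZ /= !emb_phi => /(congr1 (sep y y y)).
rewrite linearZ /= !sep_pt // crossxx !mul0r scaler0 => /eqP.
rewrite !mulf_eq0 !frob_eq0 !orbb => /eqP /(cross_eq0 y0)[c Dx]; exists c => //.
by apply: contraNneq x0 => c0; rewrite Dx c0 scale0r.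
Qed.

(** The fibres of [ppt] on the nonzero elements of L are the orbits of the nonzero scalars, each of
    size q - 1. *)
Lemma card_pts : #|pts| = ((q ^ 6 - 1) %/ (q - 1))%N.
Proof.
have q_gt1 := finNzRing_gt1 F; apply/eqP.
rewrite -(eqn_pmul2r (_ : 0 < q - 1)%N) ?subn_gt0 //.
have <-: (#|pts| * (q - 1) = q ^ 6 - 1)%N; last by rewrite mulnK ?subn_gt0.
pose A := [set x : fL | x != 0].
have oA : #|A| = (#|fL| - 1)%N.
  by rewrite subn1 -(cardC1 (0 : fL)); apply: eq_card => x; rewrite !inE.
have oF : #|[set c : F | c != 0]| = (q - 1)%N.
  by rewrite subn1 -(cardC1 (0 : F)); apply: eq_card => x; rewrite !inE.
have ->: pts = (ppt : fL -> _) @: A.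
  by apply/setP=> P; apply/pptP/imsetP=> -[x + ->]; rewrite ?inE => x0;
    exists x; rewrite ?inE.
rewrite -oL -oA -[#|A|]sum1_card (partition_big_imset (ppt : fL -> _)) /=.
rewrite -sum_nat_const; apply/esym/eq_bigr => _ /imsetP[y + ->].
rewrite inE => y0; rewrite sum1dep_card -oF.
have y_inj : injective (fun c : F => c *: y : fL).
  move=> c d /eqP; rewrite -subr_eq0 -scalerBl scaler_eq0 (negPf y0) orbF.
  by rewrite subr_eq0 => /eqP.
rewrite -(card_imset _ y_inj); apply: eq_card => x; rewrite !inE.
apply/andP/imsetP => [[x0 /eqP/(ppt_inj x0 y0)[c c0 ->]] | [c c0 ->]].
  by exists c; rewrite ?inE.
by rewrite inE in c0; rewrite scaler_eq0 negb_or c0 y0 pptZ.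
Qed.

(** For each index, the [sep] built from the other three elements kills their terms and leaves the
    chosen coefficient times a nonzero element. *)
Lemma four_independent (f : 'I_4 -> L) (u : 'I_4 -> F) :
    (forall i j, i != j -> cross (f i) (f j) != 0) ->
  \sum_i u i *: pt (f i) = 0 -> forall i, u i = 0.
Proof.
move=> f_cross e i0; pose y j := f (lift i0 j).
have := congr1 (sep (y 0) (y 1) (y 2%:R)) e; rewrite linear0 linear_sum (bigD1 i0) //=.
rewrite big1 ?addr0 => [|i]; last first.
  case: (unliftP i0 i) => [j -> _ | ->]; last by rewrite eqxx.
  rewrite linearZ /= sep_pt //.
  suff ->: cross (y j) (y 0) * frob 2 (cross (y j) (y 1))
             * frob 4 (cross (y j) (y 2%:R)) = 0.
    by rewrite scaler0.
  apply/eqP; rewrite !mulf_eq0 !frob_eq0; case: j => [[|[|[|j]]] lt_j] //.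
  - by rewrite [Ordinal _](_ : _ = 0) ?crossxx ?eqxx //; apply: val_inj.
  - by rewrite [Ordinal _](_ : _ = 1) ?crossxx ?eqxx ?orbT //; apply: val_inj.
  - by rewrite [Ordinal _](_ : _ = 2%:R) ?crossxx ?eqxx ?orbT //; apply: val_inj.
rewrite linearZ /= sep_pt // => /eqP; rewrite scaler_eq0 !mulf_eq0 !frob_eq0.
by rewrite !(negPf (f_cross _ _ _)) ?neq_lift // !orbF => /eqP.
Qed.

(** Four distinct points would give four independent vectors in a space of rank 3. *)
Lemma pts_planes (S : 'M[F]_14) : \rank S = 3%N -> (#|pts_in pts S| <= 3)%N.
Proof.
move=> rS; rewrite leqNgt; apply/negP => /card_geqP[s [Us sz sS]].
have sP (i : 'I_4) : s`_i \in pts_in pts S by rewrite sS // mem_nth // sz.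
have /fin_all_exists2[f f0 Df] (i : 'I_4) : exists2 x : L, x != 0 & s`_i = ppt x.
  by apply/pptP; have := sP i; rewrite inE => /andP[].
have f_cross i j : i != j -> cross (f i) (f j) != 0.
  apply: contra => /eqP/(cross_eq0 (f0 j))[c Dc].
  have c0 : c != 0 by apply: contraNneq (f0 i) => c0; rewrite Dc c0 scale0r.
  by rewrite -val_eqE /= -(nth_uniq 0 _ _ Us) ?sz // !Df Dc pptZ.
pose M := \matrix_(i < 4) phi (f i).
have MS : (M <= S)%MS.
  apply/row_subP => i; rewrite rowK; have := sP i.
  by rewrite inE Df genmxE => /andP[].
suff /eqP rM : row_free M by have := mxrankS MS; rewrite rM rS.
apply: inj_row_free => v vM; apply/rowP => i; rewrite [RHS]mxE.
apply: (four_independent f_cross) i; have := congr1 emb vM.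
rewrite linear0 mulmx_sum_row linear_sum => e; apply: etrans e.
by apply: eq_bigr => i _; rewrite linearZ /= rowK emb_phi.
Qed.

Lemma pts_span : (1%:M <= \sum_(P in pts) P)%MS.
Proof.
set S := (\sum_(P in pts) P)%MS.
have phiS x : (phi x <= S)%MS.
  (* The family generating [ptspan] includes [pt 0], which is zero and gives no point. *)
  have [->|x0] := eqVneq x 0; first by rewrite /phi pt0 linear0 sub0mx.
  rewrite -(genmxE (phi x)) (sumsmx_sup (ppt x)) //.
  by apply/pptP; exists x.
apply/row_subP => i; rewrite -(co_emb (row i _)).
rewrite (coord_span (emb_span _)) linear_sum summx_sub // => j _.
rewrite linearZ scalemx_sub //.
have /mapP[x _ ->] : [seq pt (x : L) | x : fL]`_j \in [seq pt (x : L) | x : fL].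
  by rewrite mem_nth ?size_image ?ltn_ord ?(leq_trans (ltn_ord j)) ?size_tuple.
exact: phiS.
Qed.

Definition mult (z : L) (v : ambient L) : ambient L :=
  (mon (base_word 0) z * v.1.1, mon (base_word 1) z * v.1.2, mon (base_word 2) z * v.2).

Lemma mult_is_linear z : linear (mult z).
Proof. by move=> a u v; rewrite /mult !mulrDr -!scalerAr. Qed.
HB.instance Definition _ z :=
  GRing.isLinear.Build F (ambient L) (ambient L) _ (mult z) (mult_is_linear z).

Lemma mult_pt z x : mult z (pt x) = pt (z * x).
Proof. by rewrite /pt /mon !exprMn. Qed.

Lemma mult_span z v : v \in ptspan L -> mult z v \in ptspan L.
Proof.
move=> /(memv_img (linfun (mult z))); rewrite lfunE; apply: subvP.
rewrite limg_span; apply/span_subvP => _ /mapP[_ /mapP[x _ ->] ->].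
by rewrite lfunE /= mult_pt pt_span.
Qed.

Lemma multM z t v : mult z (mult t v) = mult (z * t) v.
Proof. by rewrite /mult /mon !exprMn !mulrA. Qed.

Lemma mult1 v : mult 1 v = v.
Proof. by case: v => -[a c] d; rewrite /mult /mon !expr1n !mul1r. Qed.

Definition mxmult z : 'M[F]_14 := lin1_mx (co \o mult z \o emb).

Lemma mxmultE z r : r *m mxmult z = co (mult z (emb r)).
Proof. by rewrite mul_rV_lin1. Qed.

Lemma phi_mxmult z x : phi x *m mxmult z = phi (z * x).
Proof. by rewrite mxmultE emb_phi mult_pt. Qed.

(** The inverse is the matrix of z^-1: [emb_co] cancels the change of coordinates between the two
    factors because [mult] preserves the span. *)
Lemma mxmult_unit z : z != 0 -> mxmult z \in unitmx.
Proof.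
move=> z0; suff /mulmx1_unit[]: mxmult z *m mxmult z^-1 = 1%:M by [].
apply/row_matrixP => i; rewrite row_mul [row i (mxmult z)]rowE !mxmultE.
by rewrite emb_co ?mult_span ?emb_span // multM mulVf // mult1 co_emb rowE mulmx1.
Qed.

(** Multiplication by y / x carries the point of x to the point of y. *)
Lemma pts_transitive : pg_transitive pts.
Proof.
have act z x : proj_act (mxmult z) (ppt x) = ppt (z * x).
  rewrite /ppt -phi_mxmult; apply: eq_genmx; apply: eqmxMr; exact: genmxE.
move=> _ _ /pptP[x x0 ->] /pptP[y y0 ->]; exists (mxmult (y / x)); split.
- by rewrite /projectivity mxmult_unit // mulf_neq0 ?invr_eq0.
- move=> _ /pptP[t t0 ->]; rewrite act; apply/pptP; exists (y / x * t) => //.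
  by rewrite !mulf_neq0 ?invr_eq0.
- by rewrite act divfK.
Qed.

(** The relation bounds the rank of the five vectors by 4, so they lie in a subspace of rank 4; the
    nonzero values of [cross] keep the five points distinct. *)
Lemma solid_of_dependent (f : 'I_5 -> L) (u : 'I_5 -> F) i0 :
    (forall i j, i != j -> cross (f i) (f j) != 0) ->
    u i0 != 0 -> \sum_i u i *: pt (f i) = 0 ->
  exists S : 'M[F]_14, \rank S = 4%N /\ (5 <= #|pts_in pts S|)%N.
Proof.
move=> f_cross ui0 e; pose M := \matrix_(i < 5) phi (f i).
have rM : (\rank M <= 4)%N.
  rewrite -ltnS ltn_neqAle rank_leq_row andbT; apply: contraNneq ui0 => rM.
  have: (\row_i u i) *m M = 0.
    rewrite mulmx_sum_row; apply: (can_inj co_emb).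
    rewrite linear0 linear_sum -[RHS]e; apply: eq_bigr => i _.
    by rewrite linearZ /= rowK mxE emb_phi.
  move/eqP; rewrite mulmx_free_eq0 /row_free ?rM // => /eqP/rowP/(_ i0).
  by rewrite !mxE => ->.
have [|S MS rS] := @rank_extend F 14 <<M>>%MS 4; first by rewrite mxrank_gen rM.
exists S; split=> //.
have f0 i : f i != 0.
  (* [lift i ord0] is an index other than i; a zero entry at i would make the [cross] of the two
     vanish. *)
  by apply: contraNneq (f_cross _ _ (neq_lift i ord0)) => ->; rewrite cross0.
have f_inj : injective (fun i => ppt (f i)).
  move=> i j eij; apply/eqP; apply: contraT => /f_cross.
  have [c _ ->] := ppt_inj (f0 i) (f0 j) eij.
  by rewrite /cross linearZ /= -!scalerAl mulrC subrr eqxx.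
rewrite -{1}(card_ord 5) -(card_imset _ f_inj); apply/subset_leq_card/subsetP.
move=> _ /imsetP[i _ ->]; rewrite inE; apply/andP; split.
  by apply/pptP; exists (f i).
rewrite genmxE (submx_trans _ MS) // genmxE -(rowK (fun i => phi (f i))).
exact: row_sub.
Qed.

End Coordinates.

(** * Calculation modulo relations with explicit cofactors *)

Section Modulo.
Variables (R : nzRingType) (m z t : R).
Hypotheses (m0 : m = 0) (z0 : z = 0) (t0 : t = 0).

(** The cofactors certify that x - y lies in the ideal generated by m, z and t; what remains is an
    identity suited to [ring]. *)
Lemma eq_mod (C A B x y : R) : x - y = m * C + z * A + t * B -> x = y.
Proof. by rewrite m0 z0 t0 !mul0r !addr0 => /eqP; rewrite subr_eq0 => /eqP. Qed.

(** Here x' is an inverse of x modulo the relations. *)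
Lemma neq0_mod (x' C A B x : R) : x * x' - 1 = m * C + z * A + t * B -> x != 0.
Proof.
move/eq_mod => xx'; apply/eqP => x0; move/eqP: xx'.
by rewrite x0 mul0r eq_sym oner_eq0.
Qed.

End Modulo.
Arguments eq_mod {R m z t} m0 z0 t0 C A B {x y}.
Arguments neq0_mod {R m z t} m0 z0 t0 x' C A B {x}.

(** * Five dependent points, which lie in a common solid *)

Section FivePoints.
Variables (F : finFieldType) (L : fieldExtType F).
Local Notation q := #|F|.
Local Notation fL := (finvect_type L).
Hypothesis oL : #|fL| = (q ^ 6)%N.

Definition five_dependent (ys : seq L) (us : seq F) :=
  [/\ size ys = 5%N, pairwise (fun x y => cross x y != 0) ys,
      exists2 i, (i < 5)%N & us`_i != 0 &
      \sum_(i < 5) us`_i *: pt ys`_i = 0].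

Lemma pt_conj (y y1 y2 y3 y4 : L) :
    frob 1 y = y1 -> frob 2 y = y2 -> frob 3 y = y3 -> frob 4 y = y4 ->
  pt y = (y * y1 * y3, y * y1 * y4, y * y2 * y4).
Proof.
by move=> <- <- <- <-; rewrite /pt !mon_frob /= !(expr0, expr1, mulr1).
Qed.

(** All values of the monomial of s are fixed by [frob k], and [mon_neq] finds one that is moved by
    [frob 1]. *)
Lemma exists_fixed (s : bitseq) k :
    size s = 6%N -> iter k (rotr 1) s = s -> rotr 1 s != s ->
  exists2 z : L, frob k z = z & frob 1 z != z.
Proof.
move=> sz6 s_k s_1; have [|x sx] := mon_neq oL _ sz6 s_1; first by rewrite size_rotr.
by exists (mon s x); rewrite frob_mon ?s_k.
Qed.

Lemma exists_quadratic : exists2 t : L, frob 2 t = t & frob 1 t != t.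
Proof. exact: (@exists_fixed (base_word 2)). Qed.

(** The exponent 1 + q^3, which is the norm from L to its subfield of order q^3. *)
Let cubic_word := [:: true; false; false; true; false; false].

Lemma exists_cubic : exists2 z : L, frob 3 z = z & frob 1 z != z.
Proof. exact: (@exists_fixed cubic_word). Qed.

(** The trace to F of this norm is a sum of three distinct monomials, so by [mon_free] it does not
    vanish identically. *)
Lemma exists_cubic_trace :
  exists2 z : L, frob 3 z = z & z + frob 1 z + frob 2 z != 0.
Proof.
pose tr x : L :=
  mon cubic_word x + frob 1 (mon cubic_word x) + frob 2 (mon cubic_word x).
have [/existsP[x trx]|/existsPn e] := boolP [exists x : fL, tr x != 0].
  by exists (mon cubic_word x); first rewrite frob_mon.
suff: 1 = 0 :> L by move/eqP; rewrite oner_eq0.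
apply: (mon_free oL (w := fun i : 'I_3 => iter i (rotr 1) cubic_word)
  (u := fun=> 1)) ord0.
- by move=> [[|[|[|i]]] ?] [[|[|[|j]]] ?] // _; apply: val_inj.
- by case=> [[|[|[|i]]] ?].
- move=> x; rewrite !big_ord_recl big_ord0 !mul1r addr0 addrA.
  have := e x; rewrite negbK /tr !frob_mon // => /eqP; exact.
Qed.

(* The points over the subfield of order q ^ 2 form a twisted cubic. *)
Lemma dim_twisted_cubic (U : {vspace ambient L}) :
    (forall v, v \in U ->
      [/\ v.1.1 = frob 1 v.1.2, frob 2 v.1.2 = v.1.2 & frob 2 v.2 = v.2]) ->
  (\dim U <= 4)%N.
Proof.
move=> Uv; pose p2 : {linear ambient L -> L} := snd \o fst.
pose p3 : {linear ambient L -> L} := snd.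
(* The third and the second entry each range over a space fixed by [frob 2], of dimension at most 2,
   and the second entry determines the first. *)
rewrite -(limg_ker_dim (linfun p3)) (@leq_add _ _ 2 2) //; last first.
  apply: leq_trans (dimvS _) (dim_fixed_le L (isT : 0 < 2)%N).
  apply/subvP => _ /memv_imgP[v /Uv[_ _ v2] ->].
  by rewrite memv_ker add_lfunE opp_lfunE id_lfunE !lfunE /= v2 subrr.
rewrite -(limg_ker_dim (linfun p2)) (@leq_add _ _ 0 2) //; last first.
  apply: leq_trans (dimvS _) (dim_fixed_le L (isT : 0 < 2)%N).
  apply/subvP => _ /memv_imgP[v /memv_capP[/Uv[_ v2 _] _] ->].
  by rewrite memv_ker add_lfunE opp_lfunE id_lfunE !lfunE /= v2 subrr.
rewrite leqn0 dimv_eq0 -subv0; apply/subvP => v.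
rewrite !memv_cap !memv_ker !lfunE /= => /andP[/andP[/Uv[v1 _ _] /eqP v3] /eqP v2].
move: v1 v2 v3; case: v => -[a b] c /= -> -> ->.
by rewrite raddf0 memv0.
Qed.

(** The elements 1 and t + c, for four values c in F, lie in the subfield of order q^2, so their
    five vectors lie in a space of dimension 4. That subfield is a line over F with q + 1 points,
    hence the bound on q. *)
Lemma five_dependent_ge4 : (4 <= q)%N -> exists ys us, five_dependent ys us.
Proof.
case/card_geqP => s [Us sz _]; have [t t2 t1] := exists_quadratic.
pose ys := 1 :: [seq t + c%:A | c <- s].
have sz5 : size ys = 5%N by rewrite /= size_map sz.
have fr1A (c : F) : frob 1 (c%:A : L) = c%:A by rewrite linearZ /= rmorph1.
have ys_cross : pairwise (fun x y => cross x y != 0) ys.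
  rewrite /ys /= pairwise_map; apply/andP; split.
    apply/allP => _ /mapP[c _ ->]; rewrite /cross raddfD /= fr1A rmorph1 !mul1r.
    by rewrite opprD addrACA subrr addr0 subr_eq0.
  move: Us; rewrite uniq_pairwise; apply: sub_pairwise => c d /= cd.
  have ->: cross (t + c%:A) (t + d%:A) = (t - frob 1 t) * (d%:A - c%:A).
    by rewrite /cross !raddfD /= !fr1A; move: (d%:A) (c%:A) => d' c'; ring.
  rewrite mulf_eq0 negb_or subr_eq0 eq_sym t1 subr_eq0 eq_sym.
  by rewrite (inj_eq (fmorph_inj (in_alg L))).
have ys_fr2 y : y \in ys -> frob 2 y = y.
  rewrite inE => /predU1P[->|/mapP[c _ ->]]; first by rewrite rmorph1.
  by rewrite raddfD /= t2 linearZ /= rmorph1.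
pose X := [seq pt y | y <- ys].
have: ~~ free X.
  rewrite /free; apply: contraTneq (dim_twisted_cubic (U := <<X>>%VS) _) => [->|v].
    by rewrite size_map sz5.
  (* The conditions of [dim_twisted_cubic] are gathered in one linear map, so that they need
     checking only on generators of the span. *)
  pose g (v : ambient L) : ambient L :=
    (v.1.1 - frob 1 v.1.2, frob 2 v.1.2 - v.1.2, frob 2 v.2 - v.2).
  have gP : linear g.
    move=> a u u'; apply: injective_projections; last first.
      by rewrite /= linearP /= scalerBr opprD addrACA.
    by apply: injective_projections; rewrite /= linearP /= scalerBr opprD addrACA.
  pose gL : {linear ambient L -> ambient L} :=
    HB.pack g (GRing.isLinear.Build F (ambient L) (ambient L) _ g gP).
  have XP : (<<X>> <= lker (linfun gL))%VS.
    apply/span_subvP => _ /mapP[y /ys_fr2 y2 ->].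
    rewrite memv_ker lfunE /= /g.
    have y3 : frob 3 y = frob 1 y by rewrite -(frobD 1 2) y2.
    have y4 : frob 4 y = y by rewrite -(frobD 2 2) !y2.
    rewrite (pt_conj (erefl _) y2 y3 y4) /= !rmorphM /= !frobD y2 y3.
    by apply/eqP; congr (_, _, _); ring.
  move=> /(subvP XP); rewrite memv_ker lfunE /= => /eqP[/eqP + /eqP + /eqP].
  by rewrite !subr_eq0 => /eqP ? /eqP ? /eqP ?.
move=> X_dep.
(* Coefficients are extracted from non-freeness: without a nontrivial relation, [freeP] would make X
   free. *)
have [/existsP[u /andP[/existsP[i ui] /eqP u0]] | /existsPn no_u] :=
    boolP [exists u : {ffun 'I_5 -> F},
      [exists i, u i != 0] && (\sum_i u i *: pt ys`_i == 0)].
  exists ys, (mkseq (fun i => u (inord i)) 5); split=> //.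
    by exists i => //; rewrite nth_mkseq // inord_val.
  rewrite -[RHS]u0; apply: eq_bigr => j _.
  by rewrite nth_mkseq // inord_val.
have szX : size X == 5%N by rewrite size_map sz5.
case/negP: X_dep; apply/(@freeP _ _ _ (Tuple szX)) => k k0 i; apply/eqP.
apply: contraT => ki; case/negP: (no_u (finfun k)); apply/andP; split.
  by apply/existsP; exists i; rewrite ffunE.
apply/eqP; rewrite -[RHS]k0; apply: eq_bigr => j _; rewrite ffunE.
by rewrite (nth_map 0) ?sz5.
Qed.

(* C, A, B below are cofactors: they come from reducing polynomials in v and w
   modulo the relations hv, hw and the characteristic. *)
Lemma five_dependent_2 : q = 2 -> exists ys us, five_dependent ys us.
Proof.
move=> oF; have two0 : 2%:R = 0 :> L.
  have : 2 \in [pchar L] by rewrite pchar_lalg (@card_finPcharP F 2 1).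
  by case/andP => _ /eqP.
(* A generator of the field of order 4: X^4 - X = (X^2 - X)(X^2 + X + 1). *)
have [w hw]: exists w : L, w ^+ 2 + w + 1 = 0.
  have [t t4 t2]: exists2 t : L, t ^+ 4 = t & t ^+ 2 != t.
    by have := exists_quadratic; rewrite /frob oF.
  exists t; have /eqP: (t ^+ 2 - t) * (t ^+ 2 + t + 1) = 0.
    by transitivity (t ^+ 4 - t); [ring | rewrite t4 subrr].
  by rewrite mulf_eq0 subr_eq0 (negPf t2) => /eqP.
(* A generator of the field of order 8. In characteristic 2, X^8 - X = (X^2 - X)(X^3 + X + 1)(X^3 +
   X^2 + 1), and X -> X + 1 exchanges the two cubics. *)
have [v hv]: exists v : L, v ^+ 3 + v + 1 = 0.
  have [z z8 z2]: exists2 z : L, z ^+ 8 = z & z ^+ 2 != z.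
    by have := exists_cubic; rewrite /frob oF.
  have /eqP: (z ^+ 2 - z) * ((z ^+ 3 + z + 1) * (z ^+ 3 + z ^+ 2 + 1)) = 0.
    transitivity (z ^+ 8 - z + 2%:R * (z ^+ 3 * (z ^+ 2 - z))); first by ring.
    by rewrite z8 two0 subrr mul0r addr0.
  rewrite !mulf_eq0 subr_eq0 (negPf z2) /= => /orP[]/eqP hz; first by exists z.
  exists (z + 1); apply: etrans hz.
  by apply: (eq_mod two0 two0 two0 (z ^+ 2 + 2%:R * z + 1) 0 0); ring.
have fr2 k x : frob k.+1 x = frob k x ^+ 2 :> L by rewrite -add1n -frobD /frob oF.
have fv1 : frob 1 v = v ^+ 2 by rewrite fr2 /frob expn0.
have fv2 : frob 2 v = v ^+ 2 + v.
  by rewrite fr2 fv1; apply: (eq_mod two0 hv hw (- v ^+ 2 - v) v 0); ring.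
have fv3 : frob 3 v = v.
  by rewrite fr2 fv2; apply: (eq_mod two0 hv hw (- (2%:R * v) - 1) (v + 2%:R) 0); ring.
have fv4 : frob 4 v = v ^+ 2 by rewrite fr2 fv3.
have fw1 : frob 1 w = w + 1.
  by rewrite fr2 /frob expn0; apply: (eq_mod two0 hv hw (- w - 1) 0 1); ring.
have fw2 : frob 2 w = w.
  by rewrite fr2 fw1; apply: (eq_mod two0 hv hw 0 0 1); ring.
have fw3 : frob 3 w = w + 1 by rewrite fr2 fw2 -fw1 fr2 /frob expn0.
have fw4 : frob 4 w = w by rewrite fr2 fw3 -fw1 -fr2 fw2.
pose morphE := (rmorph1, rmorphD, rmorphXn).
pose frE := (fv1, fv2, fv3, fv4, fw1, fw2, fw3, fw4).
(* Five elements of L = F(v, w) whose vectors sum to zero. *)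
exists [:: 1; v ^+ 2 + 1; v ^+ 2 + v + 1; v + w; v + w + 1], (nseq 5 1).
split=> //; last first.
  rewrite !big_ord_recl big_ord0 /= !scale1r addr0.
  rewrite !(pt_conj (erefl _) (erefl _) (erefl _) (erefl _)) /= !morphE /= !frE.
  congr (_, _, _) => /=.
  - apply: (eq_mod two0 hv hw (2%:R * v ^+ 2 * w + 3%:R * v ^+ 2 + v * w - v - w - 1) (2%:R
      * v ^+ 5 + 2%:R * v ^+ 4 + 4%:R * v ^+ 3 + 3%:R * v + 4%:R * w + 4%:R)
      (2%:R * v ^+ 2 + 4%:R * v + 2%:R * w + 5%:R)); ring.
  - apply: (eq_mod two0 hv hw (- (3%:R * v ^+ 2) - 2%:R * v * w - v - 2%:R * w + 2%:R)
      (2%:R * v ^+ 7 + v ^+ 6 + 2%:R * v ^+ 5 - v ^+ 4 + 4%:R * v ^+ 3 + 4%:R *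
      v ^+ 2 + 2%:R * v * w + 5%:R * v + 4%:R * w - 2%:R) (4%:R * v ^+ 2 + 2%:R
      * v + 2%:R * w + 3%:R)); ring.
  - apply: (eq_mod two0 hv hw (- (5%:R * v ^+ 2) - 4%:R * v * w - 8%:R * v - 3%:R * w - 1)
      (2%:R * v ^+ 7 + 5%:R * v ^+ 6 + 6%:R * v ^+ 5 + 3%:R * v ^+ 4 + 2%:R * v
      ^+ 3 + 5%:R * v ^+ 2 + 2%:R * v * w + 11%:R * v + 6%:R * w + 5%:R) (4%:R *
      v ^+ 2 + 4%:R * v + 2%:R * w + 1)); ring.
  by exists 0%N; rewrite /= ?oner_eq0.
(* For each of the ten pairs, an explicit inverse shows that [cross] is nonzero. *)
rewrite /= /cross !morphE /= !frE !andbT -!andbA.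
repeat (apply/andP; split).
- apply: (neq0_mod two0 hv hw (v ^+ 2 + 1) (v) (v ^+ 3 - v - 1) (0)); ring.
- apply: (neq0_mod two0 hv hw (v ^+ 2 + v + 1) (- v ^+ 2 + v + 1) (v ^+ 3 + v ^+ 2 -
    3%:R) (0)); ring.
- apply: (neq0_mod two0 hv hw (v ^+ 2) (0) (v - 1) (0)); ring.
- apply: (neq0_mod two0 hv hw (v ^+ 2) (0) (v - 1) (0)); ring.
- apply: (neq0_mod two0 hv hw (v ^+ 2) (- v ^+ 2 + v + 1) (- v ^+ 4 + v ^+ 3 + v ^+ 2 + v
    - 3%:R) (0)); ring.
- apply: (neq0_mod two0 hv hw (v ^+ 2 * w + w) (v + 2%:R * w) (- (v ^+ 4 * w) - v ^+ 3 *
    w ^+ 2 + v ^+ 3 * w + v * w ^+ 2 + 3%:R * v * w + w ^+ 2 - 2%:R * w) (-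
    (2%:R * v) - 1)); ring.
- apply: (neq0_mod two0 hv hw (v ^+ 2 * w + v ^+ 2 + w + 1) (- (2%:R * v * w) - v + w +
    1) (- (v ^+ 4 * w) - v ^+ 4 - v ^+ 3 * w ^+ 2 - v ^+ 3 * w + v * w ^+ 2 +
    5%:R * v * w + 4%:R * v + w ^+ 2 - 1) (- (2%:R * v) - 1)); ring.
- apply: (neq0_mod two0 hv hw (v ^+ 2 * w + v ^+ 2 + v * w + v + w + 1) (- (v ^+ 2 * w) -
    2%:R * v ^+ 2 - 2%:R * v * w - v + 1) (- (v ^+ 4 * w) - v ^+ 4 - v ^+ 3 *
    w ^+ 2 - v ^+ 3 * w - v ^+ 2 * w ^+ 2 + v ^+ 2 + 4%:R * v * w + 4%:R * v +
    3%:R * w ^+ 2 + 4%:R * w + 1) (2%:R * v ^+ 2 - 2%:R * v - 3%:R)); ring.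
- apply: (neq0_mod two0 hv hw (v ^+ 2 * w + v * w + w) (- (v ^+ 2 * w) - v ^+ 2 - 2%:R *
    v * w + v + 1) (- (v ^+ 4 * w) - v ^+ 3 * w ^+ 2 - v ^+ 3 * w - v ^+ 2 * w
    ^+ 2 + 4%:R * v * w + 3%:R * w ^+ 2 + 4%:R * w) (2%:R * v ^+ 2 - 2%:R * v
    - 3%:R)); ring.
- apply: (neq0_mod two0 hv hw (v ^+ 2) (- 1) (- v + 1) (0)); ring.
Qed.

(** The same method, with L generated by w and v subject to w^2 = -1 and v^3 = v + 1. *)
Lemma five_dependent_3 : q = 3 -> exists ys us, five_dependent ys us.
Proof.
move=> oF; have three0 : 3%:R = 0 :> L.
  have : 3 \in [pchar L] by rewrite pchar_lalg (@card_finPcharP F 3 1).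
  by case/andP => _ /eqP.
(* X^9 - X = (X^3 - X)(X^2 + 1)(X^4 + 1), and the square of a root of the last factor is a root of
   X^2 + 1. *)
have [w hw]: exists w : L, w ^+ 2 + 1 = 0.
  have [t t9 t3]: exists2 t : L, t ^+ 9 = t & t ^+ 3 != t.
    by have := exists_quadratic; rewrite /frob oF.
  have /eqP: (t ^+ 3 - t) * ((t ^+ 2 + 1) * ((t ^+ 2) ^+ 2 + 1)) = 0.
    by transitivity (t ^+ 9 - t); [ring | rewrite t9 subrr].
  rewrite !mulf_eq0 subr_eq0 (negPf t3) /= => /orP[]/eqP ht; first by exists t.
  by exists (t ^+ 2).
(* Additive Hilbert 90: with T = z + z_1 + z_2 the trace of z, the element v = (z_2 - z_1) / T
   satisfies v_1 - v = 1 in characteristic 3. *)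
have [v hv]: exists v : L, v ^+ 3 - v - 1 = 0.
  have [z z3 tr0] := exists_cubic_trace; set T := (X in X != 0) in tr0.
  have fT : frob 1 T = T by rewrite /T !rmorphD /= !frobD z3; ring.
  exists ((frob 2 z - frob 1 z) / T).
  have cube (x : L) : x ^+ 3 = frob 1 x by rewrite /frob oF.
  rewrite cube rmorphM fmorphV /= fT rmorphB /= !frobD z3.
  have ->: (z - frob 2 z) / T - (frob 2 z - frob 1 z) / T - 1 = - (3%:R * frob 2 z) / T.
    by rewrite /T in tr0 *; field.
  by rewrite three0 mul0r oppr0 mul0r.
have fv1 : frob 1 v = v + 1.
  by rewrite /frob oF; apply: (eq_mod three0 hv hw 0 1 0); ring.
have fw1 : frob 1 w = - w.
  by rewrite /frob oF; apply: (eq_mod three0 hv hw 0 0 w); ring.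
have frob_step k x : frob k.+1 x = frob 1 (frob k x) :> L by rewrite frobD.
have fv2 : frob 2 v = v + 2%:R by rewrite frob_step fv1 rmorphD rmorph1 /= fv1; ring.
have fv3 : frob 3 v = v.
  rewrite frob_step fv2 rmorphD rmorph_nat /= fv1.
  by apply: (eq_mod three0 hv hw 1 0 0); ring.
have fv4 : frob 4 v = v + 1 by rewrite frob_step fv3.
have fw2 : frob 2 w = w by rewrite frob_step fw1 rmorphN /= fw1 opprK.
have fw3 : frob 3 w = - w by rewrite frob_step fw2.
have fw4 : frob 4 w = w by rewrite frob_step fw3 rmorphN /= fw1 opprK.
pose morphE := (rmorph1, rmorphD, rmorphN, rmorphXn).
pose frE := (fv1, fv2, fv3, fv4, fw1, fw2, fw3, fw4).
exists [:: 1; v; v ^+ 2 - 1; v + w; v - w], [:: 1; -1; 1; 1; 1].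
split=> //; last first.
  rewrite !big_ord_recl big_ord0 /= !scaleN1r !scale1r addr0.
  rewrite !(pt_conj (erefl _) (erefl _) (erefl _) (erefl _)) /= !morphE /= !frE.
  congr (_, _, _) => /=.
  - apply: (eq_mod three0 hv hw (v ^+ 2 + v + 1) (v ^+ 3 + 2%:R * v ^+ 2 - v) (- (2%:R * v) -
      2%:R)); ring.
  - apply: (eq_mod three0 hv hw (2%:R * v ^+ 2 + 3%:R * v + 1) (v ^+ 3 + 4%:R * v ^+ 2 + 4%:R
      * v + 2%:R) (- (2%:R * v))); ring.
  - apply: (eq_mod three0 hv hw (3%:R * v ^+ 2 + 3%:R * v + 1) (v ^+ 3 + 6%:R * v ^+ 2 +
      11%:R * v + 8%:R) (6%:R * v + 6%:R)); ring.
  by exists 0%N; rewrite //= oner_eq0.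
rewrite /= /cross !morphE /= !frE !andbT -!andbA.
repeat (apply/andP; split).
- apply: (neq0_mod three0 hv hw (1) (0) (0) (0)); ring.
- apply: (neq0_mod three0 hv hw (- v ^+ 2 - v) (- v ^+ 2 - v - 1) (- (2%:R)) (0)); ring.
- apply: (neq0_mod three0 hv hw (w - 1) (w) (0) (- (2%:R))); ring.
- apply: (neq0_mod three0 hv hw (- w - 1) (- w) (0) (- (2%:R))); ring.
- apply: (neq0_mod three0 hv hw (- v ^+ 2 - 1) (- v ^+ 2 - v - 1) (- v - 1) (0)); ring.
- apply: (neq0_mod three0 hv hw (- (v ^+ 2 * w) - v * w) (- v ^+ 2 - v - 1) (2%:R * w ^+ 2)
    (3%:R * v ^+ 2 + 3%:R * v + 2%:R)); ring.
- apply: (neq0_mod three0 hv hw (v ^+ 2 * w + v * w) (- v ^+ 2 - v - 1) (2%:R * w ^+ 2)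
    (3%:R * v ^+ 2 + 3%:R * v + 2%:R)); ring.
- apply: (neq0_mod three0 hv hw (- (v ^+ 2 * w) - v ^+ 2 - w - 1) (2%:R * v ^+ 2 * w + 3%:R
    * v * w - v + w) (2%:R * v * w ^+ 2 + 3%:R * v * w + v + 2%:R * w ^+ 2 +
    3%:R * w + 1) (3%:R * v ^+ 2 + 6%:R * v + 1)); ring.
- apply: (neq0_mod three0 hv hw (v ^+ 2 * w - v ^+ 2 + w - 1) (- (2%:R * v ^+ 2 * w) - 3%:R
    * v * w - v - w) (2%:R * v * w ^+ 2 - 3%:R * v * w + v + 2%:R * w ^+ 2 -
    3%:R * w + 1) (3%:R * v ^+ 2 + 6%:R * v + 1)); ring.
- apply: (neq0_mod three0 hv hw (- (v ^+ 2 * w) - v * w) (2%:R * v ^+ 2 + 2%:R * v + 1) (-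
    (4%:R * w ^+ 2)) (- (6%:R * v ^+ 2) - 6%:R * v - 4%:R)); ring.
Qed.

Lemma exists_five_dependent : exists ys us, five_dependent ys us.
Proof.
have q_gt1 := finNzRing_gt1 F.
have [q4|q4] := leqP 4 q; first exact: five_dependent_ge4.
have [/five_dependent_2//|q2] := eqVneq q 2.
by apply: five_dependent_3; apply/eqP; rewrite eqn_leq -ltnS q4 ltn_neqAle eq_sym q2.
Qed.

End FivePoints.

(** * The construction over an arbitrary finite field *)

Theorem mainTheorem20 (F : finFieldType) :
  let q := #|F| in
  exists X : {set 'M[F]_(13.+1)},
    [/\ pg_pointset X,
        #|X| = ((q ^ 6 - 1) %/ (q - 1))%N,
        rs_set 3 2 X
      & pg_transitive X].
Proof.
move=> q; have [L oL] := @finField_ext_exists F 6 isT.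
have [b bP]: exists b : 14.-tuple (ambient L), basis_of (ptspan L) b.
  by rewrite -(dim_ptspan oL); exists (vbasis (ptspan L)); apply: vbasisP.
exists (pts b); split; [exact: pts_point | exact: card_pts | | exact: pts_transitive].
split; [exact: pts_planes | exact: pts_span |].
have [ys [us [sz5 ys_cross [i lt_i5 ui] dep]]] := exists_five_dependent oL.
apply: (solid_of_dependent oL bP (f := fun i => ys`_i) (u := fun i => us`_i)
          (i0 := Ordinal lt_i5)) => // j k.
(* [pairwise] covers only increasing pairs of indices; the antisymmetry of [cross] gives the
   others. *)
have ltP (j' k' : 'I_5) : (j' < k')%N -> cross ys`_j' ys`_k' != 0.
  by move=> lt_jk; apply: (pairwiseP 0 ys_cross); rewrite ?inE ?sz5.
rewrite -val_eqE neq_ltn => /orP[/ltP //|lt_kj].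
by rewrite cross_sym oppr_eq0 ltP.
Qed.
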